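(* Consider the problem $\mathcal{P}_3$ described in the context, with $\beta_i=\beta>0$ and $\alpha_i=\alpha/N$ for all $i$. Define $$F=\frac{\beta(N-1)}{(\beta+1+N)(\beta+1)},\quad A=\frac{\beta+F}{\beta+1+N},\quad B=\frac{\beta(\beta+F)}{(\beta+1)(\beta+1+N)},$$ $$C=1+\frac{2(\beta+F)^2}{(\beta+2)^2}-\frac{2(\beta+F)F}{\beta+2}+\frac{\beta(4-4F+F^2)}{(\beta+2)^2},$$ $$D=\frac{\left(\frac{\beta}{\beta+1+N}\right)^2}{C+(N-1)B},\quad E=\frac{N}{\beta+1+N}.$$ There is a unique Nash equilibrium among the customers and the demand response aggregator (DRA), given by the following: (i) The DRA selects the contract as $$\alpha_i^*=\frac{1-\lambda^*\left[A(1-2ND)+\frac{\beta}{\beta+1+N}(1-2E)\right]}{2(1-ND)},\qquad \lambda^*=\frac{(C+(N-1)B)\Gamma-N\alpha_i^*}{AN}.$$ (ii) The customers exert the optimal effort and report as $$a_i^*=\frac{\alpha_i^*+A\lambda^*-B\sum_{j\ne i}a_j^*}{C}=\frac{\alpha_i^*+A\lambda^*}{C+(N-1)B},\qquad R_i^*=\frac{\lambda^*-(G-Fa_i^* )+\beta x_i}{\beta+2},$$ where $$G=\frac{\lambda^*(N-1)}{\beta+1+N}+\frac{\beta(\beta+2)\sum_{j\neq i}a_j^*}{(\beta+1)(\beta+1+N)}.$$ This equilibrium always exists.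
   Context: A DRA contracts with $N$ customers. Customer $i$ chooses an effort $a_i\in\mathbb{R}$ at cost $h(a_i)=a_i^2/2$; the true load reduction is $x_i=a_i+e_i$, where the $e_i$ are i.i.d. with mean $0$ and variance $\sigma^2$. Customer $i$ learns $x_i$ (but not $x_j$, $j\ne i$) and reports $R_i\in\mathbb{R}$, a function of $x_i$, with falsification cost $\beta_i(R_i-x_i)^2/2$. She receives $\alpha_i x_i+B_i$, where the bonus is $B_i=R_i\left(\lambda-\sum_{j=1}^N R_j\right)$, $\alpha_i$ is the share and $\lambda$ is a designer-specified parameter depending on a desired total load reduction $\Gamma$. Utilities: $$V_i=\alpha_i x_i+B_i-h(a_i)-\beta_i\frac{(R_i-x_i)^2}{2},\qquad \Pi=\sum_{i=1}^N(1-\alpha_i)x_i-\sum_{i=1}^N B_i.$$ Let $\mathbb{E}_{\mathcal{E}}$ be the expectation over $e_1,\dots,e_N$ and $\mathbb{E}_{\mathcal{E}_{-i}}$ the expectation over $\{e_j\}_{j\ne i}$. Problem $\mathcal{P}_3$: the DRA maximizes $\mathbb{E}_{\mathcal{E}}[\Pi]$ over $\{\alpha_i\}$ subject to: $a_i,R_i$ are chosen by each customer $i$ to maximize $\mathbb{E}_{\mathcal{E}}[V_i]$; individual rationality $\mathbb{E}[V_i]\ge 0$; incentive compatibility $$\frac{\partial R_i}{\partial x_i}\left[\lambda+\beta_i x_i-(\beta_i+2)R_i-\sum_{j\ne i}\mathbb{E}_{\mathcal{E}_{-i}}[R_j]\right]=R_i\frac{\partial\sum_{j\ne i}\mathbb{E}_{\mathcal{E}_{-i}}[R_j]}{\partial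 x_i},\quad \frac{\partial R_i}{\partial x_i}\ge 0;$$ and expected overall load reduction $\sum_{i=1}^N\mathbb{E}_{\mathcal{E}}[x_i]=\Gamma$. Equilibrium notion: (1) for each effort profile $(a_1,\dots,a_N)$, the reports $R_i^*$ are mutual best responses, each $R_i^*$ (as a function of $x_i$) maximizing $\mathbb{E}_{\mathcal{E}_{-i}}[V_i]$ given the other customers' report functions; (2) each $a_i^*$ maximizes $\mathbb{E}_{\mathcal{E}}[V_i]$ given the efforts $a_j^*$, $j\neq i$, with the reports being the ones in (1) for the resulting effort profile; (3) the common share $\alpha_i=\alpha/N$ maximizes $\mathbb{E}_{\mathcal{E}}[\Pi]$ for the given $\lambda=\lambda^*$, with customers responding as in (1)–(2); and (4) $\lambda^*$ is such that the expected overall load reduction equals $\Gamma$. *)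

(* Defs.v *)
(* MathComp-Analysis; the real numbers are an arbitrary [R : realType]. *)
From HB Require Import structures.
From mathcomp Require Import all_boot all_order all_algebra.
From mathcomp Require Import all_classical all_reals all_analysis.
Set Implicit Arguments.
Unset Strict Implicit.
Unset Printing Implicit Defensive.
Import Order.TTheory GRing.Theory Num.Theory.
Import numFieldNormedType.Exports.
Local Open Scope classical_set_scope.
Local Open Scope ring_scope.

Section iid.
Context (d : measure_display) (T : measurableType d) (R : realType).
Context (P : probability T R) (I : finType).

Definition mutually_independent (X : I -> {RV P >-> R}) : Prop :=
  forall (J : {set I}) (A : I -> set R), (forall i, measurable (A i)) ->
    P (\bigcap_(i in [set` J]) (X i @^-1` A i)) =
    (\prod_(i in J) P (X i @^-1` A i))%E.

Definition identically_distributed (X : I -> {RV P >-> R}) : Prop :=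
  forall (i j : I) (A : set R), measurable A ->
    distribution P (X i) A = distribution P (X j) A.

End iid.

Section payoffs.
Context (R : realType) (N : nat).
Implicit Types (alpha beta a x r : 'I_N -> R) (lambda : R) (i : 'I_N).

(* In [bonus], [utility] and [profit], [a], [x] and [r] are the realized
   efforts, true load reductions and reported values (numbers). *)
Definition bonus lambda r i : R := r i * (lambda - \sum_(j < N) r j).

Definition effort_cost (y : R) : R := y ^+ 2 / 2.

Definition utility alpha beta lambda a x r i : R :=
  alpha i * x i + bonus lambda r i - effort_cost (a i)
    - beta i * ((r i - x i) ^+ 2 / 2).

Definition profit alpha lambda x r : R :=
  \sum_(i < N) (1 - alpha i) * x i - \sum_(i < N) bonus lambda r i.

End payoffs.

Section game.
Context (d : measure_display) (T : measurableType d) (R : realType).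
Context (P : probability T R) (N : nat) (e : 'I_N -> {RV P >-> R}).

(* A report rule [rep] gives, for each customer [i], the report [rep i x] sent
   when the true load reduction is [x]; a report family [rho] gives the report
   rule [rho a] used under each effort profile [a]. *)
Implicit Types (alpha beta a : 'I_N -> R) (lambda : R) (i : 'I_N).
Implicit Types (rep : 'I_N -> R -> R) (rho : ('I_N -> R) -> 'I_N -> R -> R).

Definition load a (w : T) : 'I_N -> R := fun i => a i + e i w.

Definition sent rep (x : 'I_N -> R) : 'I_N -> R := fun i => rep i (x i).

(* The weakest regularity under which the expectations over the other
   customers' noises are finite. *)
Definition admissible a rep : Prop :=
  forall i, measurable_fun [set: R] (rep i) /\
    P.-integrable [set: T] (fun w => (rep i (load a w i))%:E).

(* Expectation over the noises of the customers other than [i] of the utility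
   of customer [i] when her own load reduction is [x] and she reports [r]: the
   [i]-th coordinates are frozen, so the integrand does not involve [e i]. *)
Definition interim_utility alpha beta lambda a rep i (x r : R) : \bar R :=
  'E_P[fun w => utility alpha beta lambda a
                  [eta load a w with i |-> x]
                  [eta sent rep (load a w) with i |-> r] i]%E.

Definition mutual_best_responses alpha beta lambda a rep : Prop :=
  admissible a rep /\
  forall i (x r : R), (interim_utility alpha beta lambda a rep i x r <=
                       interim_utility alpha beta lambda a rep i x (rep i x))%E.

Definition expected_utility alpha beta lambda a rep i : \bar R :=
  'E_P[fun w => utility alpha beta lambda a
                  (load a w) (sent rep (load a w)) i]%E.

(* A deviation of [i] to effort [y] changes the effort profile, and hence the
   report rule in use. *)
Definition effort_equilibrium alpha beta lambda a rho : Prop :=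
  forall i (y : R),
    let b : 'I_N -> R := [eta a with i |-> y] in
    (expected_utility alpha beta lambda b (rho b) i <=
     expected_utility alpha beta lambda a (rho a) i)%E.

Definition customers_response alpha beta lambda a rho : Prop :=
  (forall b : 'I_N -> R, mutual_best_responses alpha beta lambda b (rho b)) /\
  effort_equilibrium alpha beta lambda a rho.

Definition expected_profit alpha lambda a rep : \bar R :=
  'E_P[fun w => profit alpha lambda (load a w) (sent rep (load a w))]%E.

Definition expected_load a : \bar R :=
  (\sum_(i < N) 'E_P[fun w => load a w i])%E.

(* [others a rep i x] is the sum over [j <> i] of the expectations of the
   reports [R_j] over the noises of the customers other than [i], given that
   the load reduction of [i] is [x]. *)
Definition others a rep i (x : R) : R :=
  \sum_(j < N | j != i)
    fine 'E_P[fun w => sent rep [eta load a w with i |-> x] j]%E.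

Definition incentive_compatible beta lambda a rep : Prop :=
  forall i (x : R),
    [/\ derivable (rep i) x 1, derivable (others a rep i) x 1,
        derive1 (rep i) x * (lambda + beta i * x - (beta i + 2) * rep i x
                           - others a rep i x)
          = rep i x * derive1 (others a rep i) x
      & 0 <= derive1 (rep i) x].

End game.

Definition common_share (R : realType) (N : nat) (alpha : R) : 'I_N -> R :=
  fun=> alpha / N%:R.

Record profile (R : realType) (N : nat) := Profile {
  total_share : R;
  bonus_param : R;
  effort : 'I_N -> R;
  report_family : ('I_N -> R) -> 'I_N -> R -> R }.

(* The report rule used in equilibrium. *)
Definition report (R : realType) (N : nat) (p : profile R N) :=
  report_family p (effort p).

(* In the second clause [bonus_param p] stays fixed while the aggregator varies
   the total share, the customers responding to each share.  The individual
   rationality constraint is not part of the equilibrium notion: the expected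
   utilities tend to [-oo] as the noise variance grows. *)
Definition is_equilibrium (d : measure_display) (T : measurableType d)
    (R : realType) (P : probability T R) (N : nat) (e : 'I_N -> {RV P >-> R})
    (beta : 'I_N -> R) (Gamma : R) (p : profile R N) : Prop :=
  [/\ customers_response e (common_share (total_share p)) beta
        (bonus_param p) (effort p) (report_family p),
      forall (alpha : R) (a : 'I_N -> R)
             (rho : ('I_N -> R) -> 'I_N -> R -> R),
        customers_response e (common_share alpha) beta (bonus_param p) a rho ->
        (expected_profit e (common_share alpha) (bonus_param p) a (rho a) <=
         expected_profit e (common_share (total_share p)) (bonus_param p)
           (effort p) (report p))%E
    & expected_load e (effort p) = Gamma%:E].

Section coefficients.
Context (R : realType) (N : nat) (beta : R).

Definition cF : R :=
  beta * (N%:R - 1) / ((beta + 1 + N%:R) * (beta + 1)).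

Definition cA : R := (beta + cF) / (beta + 1 + N%:R).

Definition cB : R :=
  beta * (beta + cF) / ((beta + 1) * (beta + 1 + N%:R)).

Definition cC : R :=
  1 + 2 * (beta + cF) ^+ 2 / (beta + 2) ^+ 2
    - 2 * (beta + cF) * cF / (beta + 2)
    + beta * (4 - 4 * cF + cF ^+ 2) / (beta + 2) ^+ 2.

Definition cD : R :=
  (beta / (beta + 1 + N%:R)) ^+ 2 / (cC + (N%:R - 1) * cB).

Definition cE : R := N%:R / (beta + 1 + N%:R).

Definition cG (lambda : R) (a : 'I_N -> R) (i : 'I_N) : R :=
  lambda * (N%:R - 1) / (beta + 1 + N%:R)
    + beta * (beta + 2) * (\sum_(j < N | j != i) a j)
        / ((beta + 1) * (beta + 1 + N%:R)).

End coefficients.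

(* Main.v *)
(* Against the expected reports of the others, the interim utility of a customer
   is a concave quadratic in her report, so the reports are affine in the true
   load reduction and their means solve a linear system (a multiple of the
   identity plus a constant matrix), which has a unique solution.  With these
   reports, the variances and covariances of the noises enter the expected
   utilities and the expected profit only through additive constants that do not
   depend on the efforts or on the share.  What remains is again the vertex of
   concave quadratics: in the effort, with leading coefficient [- C / 2], and
   then in the share, where concavity is [N * D < 1].  The share and [lambda]
   finally solve two linear equations. *)
Require Import Defs.
From HB Require Import structures.
From mathcomp Require Import all_boot all_order all_algebra.
From mathcomp Require Import all_classical all_reals all_analysis.
From mathcomp Require Import measurable_realfun ring lra.
Set Implicit Arguments.
Unset Strict Implicit.
Unset Printing Implicit Defensive.
Import Order.TTheory GRing.Theory Num.Theory.
Import numFieldNormedType.Exports.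
Local Open Scope classical_set_scope.
Local Open Scope ring_scope.

(** * Vertices of concave quadratics and rank-one linear systems *)

(** Optimality against all alternatives becomes an equation; being an equivalence, it serves both to
    derive and to verify each equilibrium condition. *)
Lemma vertex_max (R : realFieldType) (f : R -> R) (c v m : R) : 0 < c ->
  (forall y, f y = m - c * (y - v) ^+ 2) ->
  forall x, (forall y, f y <= f x) <-> x = v.
Proof.
move=> c0 fE x; split=> [/(_ v)|-> y].
  rewrite !fE subrr expr0n mulr0 subr0 => h.
  have : c * (x - v) ^+ 2 <= 0 by lra.
  rewrite pmulr_rle0// => sq_le0; apply/eqP; rewrite -subr_eq0 -sqrf_eq0.
  by rewrite eq_le sq_le0 sqr_ge0.
rewrite !fE subrr expr0n mulr0 subr0 gerBl.
by rewrite mulr_ge0 ?sqr_ge0// ltW.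
Qed.

(** Summing the equations determines the total of the [m j], and each [m i] follows. Applied with
    [p = beta + 1], [q = 1] to mean reports, and with [p = C - B], [q = B] to efforts. *)
Lemma rank_one_system (K : fieldType) (N : nat) (p q : K) (c m : 'I_N -> K) :
  p != 0 -> p + N%:R * q != 0 ->
  (forall i, p * m i + q * (\sum_j m j) = c i) <->
  (forall i, m i = (c i - q * ((\sum_j c j) / (p + N%:R * q))) / p).
Proof.
move=> p0 pNq0; split=> mE.
  have -> : \sum_j c j = (p + N%:R * q) * \sum_j m j.
    rewrite -(eq_bigr _ (fun i _ => mE i)) big_split/= -mulr_sumr.
    by rewrite sumr_const card_ord -mulr_natl; ring.
  by move=> i; rewrite -(mE i); field; rewrite pNq0 p0.
have sum_m : \sum_j m j = (\sum_j c j) / (p + N%:R * q).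
  rewrite (eq_bigr _ (fun i _ => mE i)) -mulr_suml big_split/= sumr_const.
  by rewrite card_ord -mulr_natl; field; rewrite pNq0 p0.
by move=> i; rewrite sum_m mE; field; rewrite pNq0 p0.
Qed.

(** * Signs and bounds of the coefficients *)

Section coefficients.
Context (R : realType) (N : nat) (beta : R).
Context (N_gt0 : (0 < N)%N) (beta_gt0 : 0 < beta).
Let F := cF N beta.
Let A := cA N beta.
Let B := cB N beta.
Let C := cC N beta.

Let N_ge1 : 1 <= N%:R :> R. Proof. by rewrite ler1n. Qed.

Lemma cF_ge0 : 0 <= F.
Proof.
have b0 := beta_gt0; have n1 := N_ge1.
by rewrite /F /cF divr_ge0// !mulr_ge0 ?subr_ge0//; lra.
Qed.

Lemma cF_lt1 : F < 1.
Proof.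
have b0 := beta_gt0; have n1 := N_ge1.
rewrite /F /cF ltr_pdivrMr ?mul1r; last by apply: mulr_gt0; lra.
rewrite mulrC mulrDr mulr1 ltr_wpDr// ?ltr_pM2r//; lra.
Qed.

Lemma cA_gt0 : 0 < A.
Proof.
have F0 := cF_ge0; have b0 := beta_gt0; have n1 := N_ge1.
by rewrite /A /cA divr_gt0// -/F; lra.
Qed.

Lemma cB_gt0 : 0 < B.
Proof.
have F0 := cF_ge0; have b0 := beta_gt0; have n1 := N_ge1.
by rewrite /B /cB divr_gt0 ?mulr_gt0// -/F; lra.
Qed.

(** This is the curvature of a customer's payoff in her own effort: [1 + beta] from the effort and
    falsification costs, less the gain from adjusting the report. *)
Lemma cCE : C = 1 + beta - (beta + F) ^+ 2 / (beta + 2).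
Proof.
by rewrite /C /cC -/F; field; rewrite gt_eqF//; have := beta_gt0; lra.
Qed.

(** The bound [(beta + 1) / (beta + 2)] separates the two: it is the value of the formula in [cCE]
    at [F = 1], so [F < 1] puts [C] above it, while [F < 1] and [1 <= N] put [B] below it. *)
Lemma cB_lt_cC : B < C.
Proof.
have F0 := cF_ge0; have F1 := cF_lt1; have b0 := beta_gt0; have n1 := N_ge1.
apply: (@lt_trans _ _ ((beta + 1) / (beta + 2))).
  apply: (@lt_le_trans _ _ (beta / (beta + 1 + N%:R))).
    rewrite /B /cB -/F ltr_pdivrMr; last by apply: mulr_gt0; lra.
    rewrite mulrC [X in _ < X](_ : _ = (beta + 1) * beta).
      by rewrite ltr_pM2r//; lra.
    by field; rewrite gt_eqF//; lra.
  rewrite ler_pdivrMr; last by lra.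
  rewrite mulrAC ler_pdivlMr; last by lra.
  nra.
rewrite cCE ltr_pdivrMr; last by lra.
rewrite mulrBl divfK; last by rewrite gt_eqF//; lra.
nra.
Qed.

Lemma cK_gt0 : 0 < C + (N%:R - 1) * B.
Proof.
have B0 := cB_gt0; have BC := cB_lt_cC; have n1 := N_ge1.
have : 0 <= (N%:R - 1) * B by rewrite mulr_ge0 ?subr_ge0// ltW.
lra.
Qed.

(** With [b = beta / (beta + 1 + N)], one has [B = b * ((beta + F) / (beta + 1))] and the second
    factor is at least [b]. Hence [N b^2 <= N B < C + (N - 1) B]. *)
Lemma NcD_lt1 : N%:R * cD N beta < 1.
Proof.
have F0 := cF_ge0; have b0 := beta_gt0; have n1 := N_ge1; have BC := cB_lt_cC.
rewrite /cD -/B -/C mulrA ltr_pdivrMr ?cK_gt0// mul1r.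
suff : N%:R * (beta / (beta + 1 + N%:R)) ^+ 2 <= N%:R * B by lra.
rewrite ler_pM2l; last by lra.
have -> : (beta / (beta + 1 + N%:R)) ^+ 2 =
  beta / (beta + 1 + N%:R) * (beta / (beta + 1 + N%:R)) by [].
have -> : B = beta / (beta + 1 + N%:R) * ((beta + F) / (beta + 1)).
  by rewrite /B /cB -/F; field; rewrite !gt_eqF//; lra.
rewrite ler_pM2l; last by rewrite divr_gt0//; lra.
rewrite ler_pdivrMr; last by lra.
rewrite mulrAC ler_pdivlMr; last by lra.
nra.
Qed.

End coefficients.

(** * Square-integrability and expectations of affine combinations *)

Section expectation.
Context (d : measure_display) (T : measurableType d) (R : realType).
Context (P : probability T R).

(** For a centered variable the variance is the integral of the square. *)
Lemma Lfun2_centered (X : {RV P >-> R}) (v : R) :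
  'E_P[X]%E = 0%E -> 'V_P[X]%E = v%:E -> (X : T -> R) \in Lfun P 2%:E.
Proof.
move=> EX VX; rewrite inE; apply/andP; split; rewrite inE//=.
rewrite /finite_norm unlock poweR_lty//.
suff -> : (\int[P]_x (`|X x| `^ 2)%:E = v%:E)%E by rewrite ltry.
rewrite -VX /variance covariance.unlock EX /= expectation.unlock.
apply: eq_integral => w _; congr _%:E.
rewrite powR_mulrn// real_normK ?num_real//.
by rewrite -[RHS]/((X w - 0) * (X w - 0)) subr0.
Qed.

(** In the payoffs, [Q] collects the products of noises; its expectation is left uncomputed, as it
    only has to be a constant. *)
Lemma expectation_affine (I : finType) (X : I -> T -> R) (Q f : T -> R)
    (c : R) (l : I -> R) :
  (forall i, X i \in Lfun P 1) -> Q \in Lfun P 1 ->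
  (forall w, f w = c + \sum_i l i * X i w + Q w) ->
  'E_P[f]%E = (c + \sum_i l i * fine 'E_P[X i]%E + fine 'E_P[Q]%E)%:E.
Proof.
move=> X1 Q1 fE.
have lX i : l i \o* X i \in Lfun P 1 by exact: Lfun_scale.
pose S := \sum_(g <- [seq l i \o* X i | i <- enum I]) g.
have S1 : S \in Lfun P 1.
  rewrite /S big_map; apply: rpred_sum => i _; exact: lX.
have SE w : S w = \sum_i l i * X i w.
  rewrite /S big_map fct_sumE big_enum/=.
  by apply: eq_bigr => i _; rewrite mulrC.
have -> : f = (cst c \+ S) \+ Q by apply/funext => w; rewrite fE /= SE.
have c1 : cst c \in Lfun P 1 by exact: Lfun_cst.
rewrite expectationD//; last by rewrite rpredD.
rewrite expectationD// expectation_cst /S expectation_sum; last first.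
  by move=> g /mapP[i _ ->].
rewrite big_map big_enum/= !EFinD fineK ?expectation_fin_num//.
congr (_ + _ + _)%E; rewrite -sumEFin; apply: eq_bigr => i _.
by rewrite expectationZl// EFinM fineK ?expectation_fin_num.
Qed.

End expectation.

(** * Affine reports and their means *)

(** The report of the theorem under an arbitrary effort profile; the subtracted difference of [cG]
    and [cF * b i] is the expected total report of the others. *)
Definition affine_report (R : realType) (N : nat) (beta lambda : R)
    (b : 'I_N -> R) (i : 'I_N) (x : R) : R :=
  (lambda - (cG beta lambda b i - cF N beta * b i) + beta * x) / (beta + 2).

Section affine_report.
Context (R : realType) (N : nat) (beta lambda : R).
Context (N_gt0 : (0 < N)%N) (beta_gt0 : 0 < beta).
Implicit Types (b m : 'I_N -> R).
Local Notation rho := (affine_report beta lambda).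

Let N_ge1 : 1 <= N%:R :> R. Proof. by rewrite ler1n. Qed.

Lemma sum_others_report b i :
  \sum_(j < N | j != i) rho b j (b j) = cG beta lambda b i - cF N beta * b i.
Proof.
have b0 := beta_gt0; have n1 := N_ge1.
(* Writing the sum over the others as the total minus the own effort makes each mean report
   [p + q * b j], with [p] and [q] common to all customers. *)
pose g := beta * (beta + 2) / ((beta + 1) * (beta + 1 + N%:R)).
pose p := (lambda - lambda * (N%:R - 1) / (beta + 1 + N%:R)
           - g * \sum_j b j) / (beta + 2).
pose q := (g + cF N beta + beta) / (beta + 2).
have rhoE j : rho b j (b j) = p + q * b j.
  have sumb : \sum_k b k = b j + \sum_(k < N | k != j) b k.
    by rewrite (bigD1 j).
  rewrite /affine_report /cG /p /q /g sumb.
  move: (\sum_(k < N | k != j) b k) => S.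
  by field; rewrite !gt_eqF//; lra.
under eq_bigr do rewrite rhoE.
have sum_p : \sum_(j < N | j != i) p = (N%:R - 1) * p.
  have : \sum_(j < N) p = N%:R * p by rewrite sumr_const card_ord mulr_natl.
  by rewrite (bigD1 i)//=; lra.
rewrite big_split/= sum_p -mulr_sumr /p /q /g /cG /cF.
have -> : \sum_j b j = b i + \sum_(j < N | j != i) b j by rewrite (bigD1 i).
by field; rewrite !gt_eqF//; lra.
Qed.

Lemma sum_report b : \sum_(j < N) rho b j (b j) =
  (N%:R * lambda + beta * \sum_(j < N) b j) / (beta + 1 + N%:R).
Proof.
have b0 := beta_gt0; have n1 := N_ge1; pose i := Ordinal N_gt0.
rewrite (bigD1 i)//= sum_others_report [in RHS](bigD1 i)//=.
rewrite /affine_report /cG /cF.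
by field; rewrite !gt_eqF//; lra.
Qed.

(** The hypothesis is the best-response formula averaged over the noise. It is a rank-one system,
    which the affine reports also satisfy, so the two solutions agree. *)
Lemma report_fixpoint b m :
  (forall i, m i = (lambda - \sum_(j < N | j != i) m j + beta * b i)
                     / (beta + 2)) ->
  forall i, m i = rho b i (b i).
Proof.
move=> mE; have b0 := beta_gt0; have n1 := N_ge1.
have b10 : beta + 1 != 0 by rewrite gt_eqF//; lra.
have bN0 : beta + 1 + N%:R * 1 != 0 by rewrite gt_eqF//; lra.
have aux (m' : 'I_N -> R) :
    (forall i, m' i = (lambda - \sum_(j < N | j != i) m' j + beta * b i)
                     / (beta + 2)) ->
    forall i, (beta + 1) * m' i + 1 * (\sum_j m' j) = lambda + beta * b i.
  move=> h i; rewrite (bigD1 i)//=; have := h i.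
  set S := \sum_(j < N | _) _ => ->.
  by field; rewrite gt_eqF//; lra.
move/aux/(rank_one_system _ _ b10 bN0) : mE => mE i; rewrite mE.
have /aux/(rank_one_system _ _ b10 bN0) -> // :
  forall i, rho b i (b i) =
    (lambda - \sum_(j < N | j != i) rho b j (b j) + beta * b i) / (beta + 2).
by move=> {}i; rewrite sum_others_report.
Qed.

End affine_report.

(** * Best responses in reports *)

Section responses.
Context (d : measure_display) (T : measurableType d) (R : realType).
Context (P : probability T R) (N : nat) (e : 'I_N -> {RV P >-> R}).
Context (beta : R) (N_gt0 : (0 < N)%N) (beta_gt0 : 0 < beta).
Context (e_Lfun2 : forall i, (e i : T -> R) \in Lfun P 2%:E).
Context (mean_e : forall i, 'E_P[e i]%E = 0%E).
Implicit Types (a b alpha : 'I_N -> R) (lambda : R) (i : 'I_N).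

Let e_Lfun1 i : (e i : T -> R) \in Lfun P 1.
Proof. by apply: Lfun_subset12 => //; exact: fin_num_measure. Qed.

(** Centered noises cancel in every linear term; the total noise and the noise of one customer are
    the only linear shapes that arise. *)
Lemma expectation_noise (c u v : R) i (Q f : T -> R) : Q \in Lfun P 1 ->
  (forall w, f w = c + u * (\sum_j e j w) + v * e i w + Q w) ->
  'E_P[f]%E = (c + fine 'E_P[Q]%E)%:E.
Proof.
move=> Q1 fE.
rewrite (@expectation_affine _ _ _ _ _ (fun j => e j : T -> R) Q f c
  (fun j => u + (if j == i then v else 0)))//; last first.
  move=> w; rewrite fE -[c + _ + _]addrA; congr (c + _ + _).
  under [RHS]eq_bigr do rewrite mulrDl.
  rewrite big_split/= -mulr_sumr; congr (_ + _).
  rewrite (bigD1 i)//= eqxx big1 ?addr0// => j /negbTE ->.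
  by rewrite mul0r.
rewrite big1 ?addr0// => j _.
by rewrite mean_e/= mulr0.
Qed.

Lemma mean_report lambda b i :
  fine 'E_P[fun w => affine_report beta lambda b i (load e b w i)]%E =
  affine_report beta lambda b i (b i).
Proof.
have b0 := beta_gt0.
rewrite (@expectation_noise (affine_report beta lambda b i (b i)) 0
  (beta / (beta + 2)) i (cst 0)).
- by rewrite expectation_cst/= addr0.
- exact: Lfun_cst.
- move=> w; rewrite /affine_report /load/=.
  by field; rewrite gt_eqF//; lra.
Qed.

Lemma admissible_affine_report lambda b :
  admissible e b (affine_report beta lambda b).
Proof.
move=> i; split.
  rewrite /affine_report; apply: measurable_funM => //.
  by apply: measurable_funD => //; exact: measurable_funM.
apply/Lfun1_integrable.
have -> : (fun w => affine_report beta lambda b i (load e b w i)) =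
  cst (affine_report beta lambda b i (b i)) \+ (beta / (beta + 2)) \o* e i.
  apply/funext => w; rewrite /affine_report /load/=.
  by field; rewrite gt_eqF//; have := beta_gt0; lra.
by rewrite rpredD//; [exact: Lfun_cst | exact: Lfun_scale].
Qed.

Lemma interim_utilityE alpha lambda b rep i (x r : R) : admissible e b rep ->
  interim_utility e alpha (fun=> beta) lambda b rep i x r =
  (alpha i * x
   + r * (lambda - r - \sum_(j < N | j != i)
                          fine 'E_P[fun w => rep j (load e b w j)]%E)
   - b i ^+ 2 / 2 - beta * ((r - x) ^+ 2 / 2))%:E.
Proof.
move=> adm; rewrite /interim_utility.
have l0 (F : 'I_N -> R) :
  \sum_j (if j != i then - r else 0) * F j = - (r * \sum_(j < N | j != i) F j).
  rewrite -mulNr mulr_sumr [RHS]big_mkcond/=; apply: eq_bigr => j _.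
  by case: ifP; rewrite ?mul0r.
(* The own report is the number [r], so the random reports get coefficient [0] at [i] and [- r] at
   every other index. *)
rewrite (@expectation_affine _ _ _ _ _ (fun j w => rep j (load e b w j)) (cst 0)
  _ (alpha i * x + r * (lambda - r) - b i ^+ 2 / 2 - beta * ((r - x) ^+ 2 / 2))
  (fun j => if j != i then - r else 0)).
- by rewrite l0 expectation_cst/=; congr _%:E; ring.
- by move=> j; apply/Lfun1_integrable; have [] := adm j.
- exact: Lfun_cst.
move=> w; rewrite l0 /utility /bonus /effort_cost /= eqxx (bigD1 i)//= eqxx.
rewrite (eq_bigr (fun j => rep j (load e b w j))); last first.
  by move=> j /negbTE ->.
by ring.
Qed.

(** Pointwise maximization in [x] already forces an affine rule with slope [beta / (beta + 2)]; the
    mean reports then fix the intercepts. *)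
Lemma mutual_best_responsesP alpha lambda b rep :
  mutual_best_responses e alpha (fun=> beta) lambda b rep <->
  rep = affine_report beta lambda b.
Proof.
have b0 := beta_gt0.
pose S rep i := \sum_(j < N | j != i)
  fine 'E_P[fun w => rep j (load e b w j)]%E.
pose U := interim_utility e alpha (fun=> beta) lambda b rep.
have best : admissible e b rep ->
    (forall i (x r : R), (U i x r <= U i x (rep i x))%E) <->
    (forall i x, rep i x = (lambda - S rep i + beta * x) / (beta + 2)).
  move=> adm.
  suff H i x : (forall r, (U i x r <= U i x (rep i x))%E) <->
       rep i x = (lambda - S rep i + beta * x) / (beta + 2).
    by split=> h i x; [apply/H => r; exact: h | exact: (H i x).2 (h i x)].
  pose v := (lambda - S rep i + beta * x) / (beta + 2).
  pose f r := alpha i * x + r * (lambda - r - S rep i)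
   - b i ^+ 2 / 2 - beta * ((r - x) ^+ 2 / 2).
  (* The curvature is [1] from the bonus plus [beta / 2] from the falsification cost; the maximal
     value is read off from [f 0]. *)
  rewrite -(@vertex_max _ f ((beta + 2) / 2) v (f 0 + (beta + 2) / 2 * v ^+ 2)).
  - split=> h r; last by rewrite /U !interim_utilityE// lee_fin; exact: h.
    by have := h r; rewrite /U !interim_utilityE// lee_fin.
  - by lra.
  - by move=> y; rewrite /f /v; field; rewrite gt_eqF//; lra.
split=> [[adm /(best adm) repE]|repE].
  (* Averaging the affine rule over the centered noise replaces [x] by [b i]. *)
  have m_fix i : fine 'E_P[fun w => rep i (load e b w i)]%E =
      (lambda - S rep i + beta * b i) / (beta + 2).
    rewrite (@expectation_noise ((lambda - S rep i + beta * b i) / (beta + 2)) 0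
      (beta / (beta + 2)) i (cst 0)).
    - by rewrite expectation_cst/= addr0.
    - exact: Lfun_cst.
    - by move=> w; rewrite repE /load/=; field; rewrite gt_eqF//; lra.
  apply/funext => i; apply/funext => x; rewrite repE /affine_report.
  rewrite -sum_others_report//; congr ((_ - _ + _) / _).
  apply: eq_bigr => j _.
  exact: (report_fixpoint N_gt0 beta_gt0
    (m := fun k => fine 'E_P[fun w => rep k (load e b w k)]%E) m_fix).
have adm : admissible e b rep by rewrite repE; exact: admissible_affine_report.
split=> //; apply/best => // i x.
rewrite {1}repE {1}/affine_report -sum_others_report//.
congr ((_ - _ + _) / _); apply: eq_bigr => j _.
by rewrite repE mean_report.
Qed.

(** * Choice of efforts *)

Let noise_Lfun1 i : (fun w => e i w * \sum_j e j w) \in Lfun P 1.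
Proof.
have -> : (fun w => e i w * \sum_j e j w) =
    \sum_(g <- [seq (e i : T -> R) \* e j | j <- enum 'I_N]) g.
  apply/funext => w; rewrite big_map fct_sumE big_enum/= mulr_sumr.
  by [].
by rewrite big_map; apply: rpred_sum => j _; exact: Lfun2_mul_Lfun1.
Qed.

(** The constant [kappa] is quantified before [b]: the expected products of noises do not affect
    comparisons between efforts. *)
Lemma expected_utilityE alpha lambda i : exists kappa : R, forall b,
  let m := affine_report beta lambda b i (b i) in
  let S := cG beta lambda b i - cF N beta * b i in
  expected_utility e alpha (fun=> beta) lambda b (affine_report beta lambda b) i
  = (kappa + (alpha i * b i + m * (lambda - m - S) - b i ^+ 2 / 2
              - beta * ((m - b i) ^+ 2 / 2)))%:E.
Proof.
have b0 := beta_gt0.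
pose k := beta / (beta + 2).
(* A report carries [k] times its noise and departs from the true load by [k - 1] times it; these
   are the quadratic noise terms of the bonus and of the falsification cost. *)
pose Q := (fun w => (- k ^+ 2) * (e i w * \sum_j e j w)
                    + (- (beta * ((k - 1) ^+ 2 / 2))) * (e i w * e i w)).
have Q1 : Q \in Lfun P 1.
  have -> : Q = (- k ^+ 2) \o* (fun w => e i w * \sum_j e j w) \+
    (- (beta * ((k - 1) ^+ 2 / 2))) \o* ((e i : T -> R) \* e i).
    by apply/funext => w /=; rewrite /Q; ring.
  by rewrite rpredD//; apply: Lfun_scale => //; exact: Lfun2_mul_Lfun1.
exists (fine 'E_P[Q]%E) => b m S; rewrite addrC.
apply: (expectation_noise (u := - k * m)
  (v := alpha i + k * (lambda - m - S) - beta * (m - b i) * (k - 1))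
  (i := i)) => // w.
have rE j : sent (affine_report beta lambda b) (load e b w) j =
    affine_report beta lambda b j (b j) + k * e j w.
  rewrite /sent /affine_report /load /k.
  by field; rewrite gt_eqF//; lra.
rewrite /utility /bonus /effort_cost; under eq_bigr do rewrite rE.
rewrite rE big_split/= -mulr_sumr (bigD1 i)//= sum_others_report//.
rewrite -/m -/S /Q /load.
by move: (\sum_j e j w) => s; field.
Qed.

(** A deviation in effort also changes the reports of the others: their expected total moves with
    slope [- F] in the deviator's effort, so her payoff is a quadratic with leading coefficient
    [- C / 2]. *)
Lemma effort_equilibriumP alpha lambda a :
  effort_equilibrium e alpha (fun=> beta) lambda a (affine_report beta lambda)
  <-> forall i, a i = (alpha i + cA N beta * lambda
         - cB N beta * \sum_(j < N | j != i) a j) / cC N beta.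
Proof.
have b0 := beta_gt0; have n1 : 1 <= N%:R :> R by rewrite ler1n.
have C0 : 0 < cC N beta.
  exact: lt_trans (cB_gt0 N_gt0 beta_gt0) (cB_lt_cC N_gt0 beta_gt0).
pose U b := expected_utility e alpha (fun=> beta) lambda b
  (affine_report beta lambda b).
suff H i : (forall y : R, (U [eta a with i |-> y] i <= U a i)%E) <->
   a i = (alpha i + cA N beta * lambda
         - cB N beta * \sum_(j < N | j != i) a j) / cC N beta.
  by split=> h i; [apply/H => y; exact: h | exact: (H i).2 (h i)].
have [kappa kE] := expected_utilityE alpha lambda i.
set v := (X in _ = X).
set s := \sum_(j < N | _) _ in v *.
(* This is [cG] at index [i], which a deviation by [i] leaves unchanged. *)
pose g := lambda * (N%:R - 1) / (beta + 1 + N%:R)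
    + beta * (beta + 2) * s / ((beta + 1) * (beta + 1 + N%:R)).
pose f y := let S := g - cF N beta * y in
  let m := (lambda - S + beta * y) / (beta + 2) in
  alpha i * y + m * (lambda - m - S) - y ^+ 2 / 2 - beta * ((m - y) ^+ 2 / 2).
have fE y : f y = f 0 + cC N beta / 2 * v ^+ 2 - cC N beta / 2 * (y - v) ^+ 2.
  have -> : f y = f 0 + cC N beta * v * y - cC N beta / 2 * y ^+ 2.
    rewrite [cC N beta * v]mulrC divfK ?gt_eqF// cCE// /cA /cB /f /g.
    by field; rewrite !gt_eqF//; lra.
  by field.
have uE b : (forall j, j != i -> b j = a j) -> U b i = (kappa + f (b i))%:E.
  move=> ba; rewrite /U kE /f /affine_report /cG.
  by rewrite (eq_bigr a) -/s.
rewrite -(vertex_max (f := f) (c := cC N beta / 2) _ fE); last by lra.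
have uyE y : U [eta a with i |-> y] i = (kappa + f y)%:E.
  by rewrite uE/= ?eqxx// => j /negbTE ->.
by split=> h y; have := h y; rewrite uyE uE// lee_fin lerD2l.
Qed.

(** Since reports must be best responses under every effort profile, the whole report family is
    determined, also away from the equilibrium efforts. *)
Lemma customers_responseP (alpha : R) lambda a rho :
  customers_response e (common_share alpha) (fun=> beta) lambda a rho <->
  rho = affine_report beta lambda /\
  a = fun=> (alpha / N%:R + cA N beta * lambda)
            / (cC N beta + (N%:R - 1) * cB N beta).
Proof.
have b0 := beta_gt0; have n1 : 1 <= N%:R :> R by rewrite ler1n.
have BC := cB_lt_cC N_gt0 beta_gt0; have B0 := cB_gt0 N_gt0 beta_gt0.
have K0 := cK_gt0 N_gt0 beta_gt0.
have p0 : cC N beta - cB N beta != 0 by rewrite gt_eqF//; lra.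
have pNq0 : cC N beta - cB N beta + N%:R * cB N beta != 0.
  by rewrite gt_eqF//; lra.
have effortE : effort_equilibrium e (common_share alpha) (fun=> beta) lambda a
    (affine_report beta lambda) <->
  a = fun=> (alpha / N%:R + cA N beta * lambda)
            / (cC N beta + (N%:R - 1) * cB N beta).
  rewrite effort_equilibriumP.
  pose c := fun _ : 'I_N => alpha / N%:R + cA N beta * lambda.
  (* Completing the sum with the own effort turns the diagonal coefficient [C] into [C - B]. *)
  have sysE i : a i = (common_share alpha i + cA N beta * lambda
         - cB N beta * \sum_(j < N | j != i) a j) / cC N beta <->
      (cC N beta - cB N beta) * a i + cB N beta * (\sum_j a j) = c i.
    have -> : \sum_j a j = a i + \sum_(j < N | j != i) a j.
      by rewrite (bigD1 i).
    move: (\sum_(j < N | _) _) => s; rewrite /c /common_share; split=> [->|<-].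
      by field; rewrite gt_eqF//; lra.
    by field; rewrite gt_eqF//; lra.
  have sumc : \sum_j c j = N%:R * (alpha / N%:R + cA N beta * lambda).
    by rewrite sumr_const card_ord mulr_natl.
  (* The right-hand side is the same for all customers, so the rank-one solution collapses to a
     common effort. *)
  have solE : (alpha / N%:R + cA N beta * lambda)
            / (cC N beta + (N%:R - 1) * cB N beta) =
    (alpha / N%:R + cA N beta * lambda - cB N beta * ((\sum_j c j) /
       (cC N beta - cB N beta + N%:R * cB N beta))) / (cC N beta - cB N beta).
    by rewrite sumc; field; rewrite pNq0 p0 !gt_eqF//; lra.
  split=> [h|aE i].
    apply/funext => i; rewrite solE.
    have /(rank_one_system _ _ p0 pNq0) -> // :
      forall i, (cC N beta - cB N beta) * a i + cB N beta * (\sum_j a j) = c i.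
    by move=> j; apply/sysE.
  apply/sysE; move: i; apply/(rank_one_system _ _ p0 pNq0) => i.
  by rewrite aE solE.
rewrite -effortE; split=> [[mbr eff]|[-> eff]].
  have rhoE : rho = affine_report beta lambda.
    apply/funext => b.
    exact/(mutual_best_responsesP (common_share alpha)).
  by split=> //; rewrite -rhoE.
split=> // b.
exact/mutual_best_responsesP.
Qed.

(** * Expected profit and expected load *)

(** The bonuses depend only on the total report, whose mean is [M]. Constant efforts suffice because
    responses to a common share are symmetric. *)
Lemma expected_profitE lambda : exists kappa : R, forall alpha y : R,
  let M := cE N beta * lambda + cE N beta * beta * y in
  expected_profit e (common_share alpha) lambda (fun=> y)
    (affine_report beta lambda (fun=> y)) =
  (kappa + (N%:R * (1 - alpha / N%:R) * y - M * (lambda - M)))%:E.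
Proof.
have b0 := beta_gt0; have n1 : 1 <= N%:R :> R by rewrite ler1n.
pose i := Ordinal N_gt0; pose k := beta / (beta + 2).
pose Q := fun w => k ^+ 2 * ((\sum_j e j w) * (\sum_j e j w)).
have Q1 : Q \in Lfun P 1.
  pose S j : T -> R := fun w => e j w * \sum_l e l w.
  have -> : Q = k ^+ 2 \o* (\sum_(g <- [seq S j | j <- enum 'I_N]) g).
    apply/funext => w /=.
    by rewrite big_map fct_sumE big_enum/= /Q mulrC -mulr_suml.
  apply: Lfun_scale => //; rewrite big_map; apply: rpred_sum => j _.
  exact: noise_Lfun1.
exists (fine 'E_P[Q]%E) => alpha y M; rewrite addrC.
apply: (expectation_noise
  (u := 1 - alpha / N%:R - k * (lambda - 2 * M)) (v := 0) (i := i)) => // w.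
pose r := sent (affine_report beta lambda (fun=> y)) (load e (fun=> y) w).
have rE j : r j = affine_report beta lambda (fun=> y) j y + k * e j w.
  rewrite /r /sent /affine_report /load /k.
  by field; rewrite gt_eqF//; lra.
have sumR : \sum_j r j = M + k * \sum_j e j w.
  under eq_bigr do rewrite rE.
  rewrite big_split/= -mulr_sumr; congr (_ + _).
  rewrite (sum_report lambda N_gt0 beta_gt0 (fun=> y)) sumr_const card_ord.
  rewrite -mulr_natl /M /cE.
  by field; rewrite gt_eqF//; lra.
rewrite /profit /bonus /common_share -/r -mulr_sumr -mulr_suml sumR.
rewrite /load big_split/= sumr_const card_ord -[y *+ N]mulr_natl /Q.
by move: (\sum_j e j w) => s; ring.
Qed.

Lemma expected_loadE a : expected_load e a = (\sum_i a i)%:E.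
Proof.
rewrite /expected_load -sumEFin; apply: eq_bigr => i _.
rewrite (expectation_noise (c := a i) (u := 0) (v := 1) (i := i) (Q := cst 0)).
- by rewrite expectation_cst/= addr0.
- exact: Lfun_cst.
- by move=> w; rewrite /load/=; ring.
Qed.

(** * Equilibria as solutions of the contract equations *)

Lemma is_equilibriumP Gamma (p : profile R N) :
  let lambda := bonus_param p in
  let K := cC N beta + (N%:R - 1) * cB N beta in
  let alpha := total_share p / N%:R in
  is_equilibrium e (fun=> beta) Gamma p <->
  [/\ report_family p = affine_report beta lambda,
      effort p = (fun=> (alpha + cA N beta * lambda) / K),
      alpha = (1 - lambda * (cA N beta * (1 - 2 * N%:R * cD N beta)
                      + beta / (beta + 1 + N%:R) * (1 - 2 * cE N beta)))
              / (2 * (1 - N%:R * cD N beta))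
    & lambda = (K * Gamma - N%:R * alpha) / (cA N beta * N%:R)].
Proof.
move=> lambda K alpha.
have b0 := beta_gt0; have n1 : 1 <= N%:R :> R by rewrite ler1n.
have K0 : 0 < K := cK_gt0 N_gt0 beta_gt0.
have A0 := cA_gt0 N_gt0 beta_gt0; have ND1 := NcD_lt1 N_gt0 beta_gt0.
(* The common effort induced by the total share [t] when [lambda] is held fixed. *)
pose y t := (t / N%:R + cA N beta * lambda) / K.
have [kappa kE] := expected_profitE lambda.
pose f t := let M := cE N beta * lambda + cE N beta * beta * y t in
  N%:R * (1 - t / N%:R) * y t - M * (lambda - M).
pose v := N%:R * ((1 - lambda * (cA N beta * (1 - 2 * N%:R * cD N beta)
                      + beta / (beta + 1 + N%:R) * (1 - 2 * cE N beta)))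
              / (2 * (1 - N%:R * cD N beta))).
(* In the leading coefficient, [1 / (K * N)] comes from the share payments and [D / K] from the
   squared mean total report. *)
have fE t : f t = f 0 + (1 - N%:R * cD N beta) / (K * N%:R) * v ^+ 2
                  - (1 - N%:R * cD N beta) / (K * N%:R) * (t - v) ^+ 2.
  suff -> : f t = f 0 + 2 * ((1 - N%:R * cD N beta) / (K * N%:R)) * v * t
                  - (1 - N%:R * cD N beta) / (K * N%:R) * t ^+ 2.
    by ring.
  have -> : 2 * ((1 - N%:R * cD N beta) / (K * N%:R)) * v =
    (1 - lambda * (cA N beta * (1 - 2 * N%:R * cD N beta)
                      + beta / (beta + 1 + N%:R) * (1 - 2 * cE N beta))) / K.
    by rewrite /v; field; rewrite !gt_eqF//; lra.
  rewrite /f /y /cD -/K /cE; move: (cA N beta) => A.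
  by field; rewrite !gt_eqF//; lra.
have profit_max : (forall t, f t <= f (total_share p)) <-> total_share p = v.
  apply: vertex_max fE _; rewrite divr_gt0 ?mulr_gt0//; lra.
have alphaE : total_share p = v <-> alpha = v / N%:R.
  rewrite /alpha; split=> [->//|h].
  by rewrite -[total_share p](divfK (x := N%:R)) ?h ?divfK// gt_eqF//; lra.
have loadE : effort p = (fun=> y (total_share p)) ->
    expected_load e (effort p) = Gamma%:E <->
    lambda = (K * Gamma - N%:R * alpha) / (cA N beta * N%:R).
  move=> ->; rewrite expected_loadE sumr_const card_ord -[_ *+ N]mulr_natl.
  rewrite /y -/alpha; split=> [[<-]|h].
    by field; rewrite !gt_eqF//; lra.
  congr _%:E; rewrite [X in alpha + _ * X]h.
  by field; rewrite !gt_eqF//; lra.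
have vN : v / N%:R = (1 - lambda * (cA N beta * (1 - 2 * N%:R * cD N beta)
                      + beta / (beta + 1 + N%:R) * (1 - 2 * cE N beta)))
              / (2 * (1 - N%:R * cD N beta)).
  by rewrite /v mulrC mulKf// gt_eqF//; lra.
rewrite -vN.
have respP t a rho :
    customers_response e (common_share t) (fun=> beta) lambda a rho <->
    rho = affine_report beta lambda /\ a = fun=> y t.
  exact: customers_responseP.
rewrite /is_equilibrium /report -/lambda; split.
  move=> [/respP[rhoE aE] best load]; split=> //; last exact/loadE.
  apply/alphaE/profit_max => t.
  have /best : customers_response e (common_share t) (fun=> beta) lambda
    (fun=> y t) (affine_report beta lambda) by exact/respP.
  by rewrite rhoE aE !kE lee_fin lerD2l.
move=> [rhoE aE /alphaE/profit_max best load]; split.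
- exact/respP.
- move=> t a rho /respP[-> ->].
  by rewrite rhoE aE !kE lee_fin lerD2l; exact: best.
- exact/loadE.
Qed.

End responses.

(** * Incentive compatibility *)

(** Each report depends on the own load only, so the others' mean reports are constant in [x] and
    the right side vanishes; the bracket on the left is the first-order condition of the report,
    hence zero. *)
Lemma affine_report_incentive_compatible (d : measure_display)
    (T : measurableType d) (R : realType) (P : probability T R) (N : nat)
    (e : 'I_N -> {RV P >-> R}) (beta lambda : R) (a : 'I_N -> R) :
  0 < beta -> (forall i, (e i : T -> R) \in Lfun P 2%:E) ->
  (forall i, 'E_P[e i]%E = 0%E) ->
  incentive_compatible e (fun=> beta) lambda a (affine_report beta lambda a).
Proof.
move=> b0 e2 Ee i x; have N_gt0 : (0 < N)%N by case: N i {e e2 Ee a x} => [[]|].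
have othersE : others e a (affine_report beta lambda a) i =
    cst (cG beta lambda a i - cF N beta * a i).
  apply/funext => z; rewrite -(sum_others_report lambda N_gt0 b0).
  apply: eq_bigr => j ji.
  rewrite -(mean_report b0 e2 Ee); congr (fine 'E_P[_]%E).
  by apply/funext => w; rewrite /sent/= (negbTE ji).
have dR : is_derive x 1 (affine_report beta lambda a i) (beta / (beta + 2)).
  have -> : affine_report beta lambda a i =
    (fun z => (lambda - (cG beta lambda a i - cF N beta * a i)) / (beta + 2)
              + beta / (beta + 2) * z).
    by apply/funext => z; rewrite /affine_report; field; rewrite gt_eqF//; lra.
  apply: is_derive_eq.
  by rewrite /GRing.scale/=; ring.
have dR' : derive1 (affine_report beta lambda a i) x = beta / (beta + 2).
  by rewrite derive1E derive_val.
split.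
- exact: ex_derive.
- by rewrite othersE.
- rewrite dR' othersE derive1_cst mulr0 /affine_report/=.
  by field; rewrite gt_eqF//; lra.
- by rewrite dR' divr_ge0//; lra.
Qed.

(** * Existence, uniqueness and form of the equilibrium *)

Theorem theorem6 (d : measure_display) (T : measurableType d) (R : realType)
    (P : probability T R) (N : nat) (e : 'I_N -> {RV P >-> R})
    (sigma beta Gamma : R)
    (N_gt0 : (0 < N)%N) (beta_gt0 : 0 < beta)
    (indep_e : mutually_independent e) (ident_e : identically_distributed e)
    (mean_e : forall i : 'I_N, 'E_P[e i]%E = 0%E)
    (var_e : forall i : 'I_N, 'V_P[e i]%E = (sigma ^+ 2)%:E) :
  let F := cF N beta in
  let A := cA N beta in
  let B := cB N beta in
  let C := cC N beta in
  let D := cD N beta in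
  let E := cE N beta in
  [/\ C != 0, C + (N%:R - 1) * B != 0, A * N%:R != 0 & 1 - N%:R * D != 0] /\
  (exists! p : profile R N, is_equilibrium e (fun=> beta) Gamma p) /\
  (forall p : profile R N, is_equilibrium e (fun=> beta) Gamma p ->
     let lambda := bonus_param p in
     let alpha := total_share p / N%:R in
     let a := effort p in
     [/\ incentive_compatible e (fun=> beta) lambda a (report p),
         alpha =
           (1 - lambda * (A * (1 - 2 * N%:R * D)
                          + beta / (beta + 1 + N%:R) * (1 - 2 * E)))
             / (2 * (1 - N%:R * D)),
         lambda =
           ((C + (N%:R - 1) * B) * Gamma - N%:R * alpha) / (A * N%:R),
         forall i : 'I_N,
           a i = (alpha + A * lambda - B * \sum_(j < N | j != i) a j) / C /\
           a i = (alpha + A * lambda) / (C + (N%:R - 1) * B)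
       & forall (i : 'I_N) (x : R),
           report p i x =
             (lambda - (cG beta lambda a i - F * a i) + beta * x)
               / (beta + 2)]).
Proof.
move=> F A B C D E.
have n1 : 1 <= N%:R :> R by rewrite ler1n.
have F0 : 0 <= F := cF_ge0 N_gt0 beta_gt0.
have A0 : 0 < A := cA_gt0 N_gt0 beta_gt0.
have B0 : 0 < B := cB_gt0 N_gt0 beta_gt0.
have BC : B < C := cB_lt_cC N_gt0 beta_gt0.
have K0 : 0 < C + (N%:R - 1) * B := cK_gt0 N_gt0 beta_gt0.
have ND1 : N%:R * D < 1 := NcD_lt1 N_gt0 beta_gt0.
have AN0 : 0 < A * N%:R by rewrite mulr_gt0//; lra.
have e2 i : (e i : T -> R) \in Lfun P 2%:E.
  exact: Lfun2_centered (mean_e i) (var_e i).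
have equilibriumP p := is_equilibriumP N_gt0 beta_gt0 e2 mean_e Gamma p.
split; first by split; rewrite gt_eqF//; lra.
split; last first.
  move=> p /equilibriumP[rhoE aE alphaE lambdaE] lambda alpha a.
  rewrite /report rhoE; split=> //.
    exact: affine_report_incentive_compatible.
  move=> i.
  (* The recursive effort formula is the equilibrium condition itself; the closed form is [aE]. *)
  have /(effort_equilibriumP N_gt0 beta_gt0 e2 mean_e)/(_ i) :
    effort_equilibrium e (common_share (total_share p)) (fun=> beta) lambda a
      (affine_report beta lambda).
    exact: (((customers_responseP N_gt0 beta_gt0 e2 mean_e _ _ _ _).2
      (conj erefl aE)).2).
  by move=> h; split; [exact: h | rewrite /a aE].
pose K := C + (N%:R - 1) * B.
pose b := beta / (beta + 1 + N%:R).
(* Eliminating the share from the two linear equations of the contract leaves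
   [lambda * Z = 2 * (1 - N%:R * D) * K * Gamma / N%:R - 1]. *)
pose Z := A - b * (1 - 2 * E).
(* The terms in [beta] of [A] and [b] cancel. Positivity makes the eliminated equation solvable for
   every [Gamma]. *)
have Z0 : 0 < Z.
  have -> : Z = (F + 2 * beta * E) / (beta + 1 + N%:R).
    by rewrite /Z /A /cA -/F /b; field; rewrite gt_eqF//; lra.
  have E0 : 0 < E by rewrite divr_gt0//; lra.
  have : 0 < beta * E by rewrite mulr_gt0.
  by move=> bE0; rewrite divr_gt0//; lra.
pose lam := (2 * (1 - N%:R * D) * K * Gamma / N%:R - 1) / Z.
pose sh := (K * Gamma - N%:R * (A * lam)) / N%:R.
(* The load equation is solved for the share and substituted into the other one. Right to left gives
   existence, left to right uniqueness. *)
have contractP (lambda alpha : R) :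
  (alpha = (1 - lambda * (A * (1 - 2 * N%:R * D) + b * (1 - 2 * E)))
             / (2 * (1 - N%:R * D)) /\
   lambda = (K * Gamma - N%:R * alpha) / (A * N%:R)) <->
  lambda = lam /\ alpha = sh.
  have -> : (lambda = (K * Gamma - N%:R * alpha) / (A * N%:R)) <->
            alpha = (K * Gamma - N%:R * (A * lambda)) / N%:R.
    by split=> ->; field; rewrite !gt_eqF//; lra.
  split=> [[aE alE]|[-> ->]].
    suff lE : lambda = lam by rewrite alE lE.
    have : 2 * (1 - N%:R * D) * alpha =
        1 - lambda * (A * (1 - 2 * N%:R * D) + b * (1 - 2 * E)).
      by rewrite aE mulrC divfK// gt_eqF//; lra.
    have -> : A * (1 - 2 * N%:R * D) + b * (1 - 2 * E) =
      2 * A * (1 - N%:R * D) - Z by rewrite /Z; ring.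
    rewrite alE => h; apply: (mulIf (x := Z)); first by rewrite gt_eqF.
    rewrite /lam divfK ?gt_eqF//.
    have -> : lambda * Z = 1 - lambda * (2 * A * (1 - N%:R * D) - Z) - 1
        + 2 * (1 - N%:R * D) * (A * lambda) by ring.
    by rewrite -h; field; rewrite gt_eqF//; lra.
  split=> //.
  have -> : A * (1 - 2 * N%:R * D) + b * (1 - 2 * E) =
      2 * A * (1 - N%:R * D) - Z by rewrite /Z; ring.
  rewrite mulrBr [lam * Z]divfK ?gt_eqF// /sh.
  by field; rewrite !gt_eqF//; lra.
(* The record stores the total share, hence the factor [N] on the individual share [sh]. *)
pose p : profile R N := Profile (N%:R * sh) lam (fun=> (sh + A * lam) / K)
  (affine_report beta lam).
have shK : N%:R * sh / N%:R = sh by rewrite mulrC mulKf// gt_eqF//; lra.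
exists p; split.
  apply/equilibriumP; rewrite /= shK -/A -/B -/C -/D -/E -/K -/b.
  by have [] := (contractP lam sh).2 (conj erefl erefl); split.
move=> [t l a rho] /equilibriumP /= [-> -> alphaE lambdaE].
have [lE tE] := (contractP _ _).1 (conj alphaE lambdaE).
rewrite /p -tE -lE; congr Profile.
by rewrite mulrC divfK// gt_eqF//; lra.
Qed.
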